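(* Let $G$ be a connected $r$-regular simple graph of order $N$ and size $m=Nr/2$, with $r\ge2$, and let $\widehat G$ be its full-loop graph. Let $H=L(\widehat G)$ be the line graph of $\widehat G$, and let $\widetilde H$ be the Açıkmeşe lift of the self-loop graph $H$. Then, for every $t>0$, $$\chi_t^{\widetilde H}(g)=1+e^{-\eta^-t}+e^{-\eta^+t}-e^{-\rho_1^-t}-e^{-\rho_1^+t},$$ where $$\rho_1^\pm=\frac{r+3\pm\sqrt{(r+1)^2+4r}}2,\qquad \eta^\pm=\frac{2N+r+3\pm\sqrt{(2N-r-1)^2+4r}}2.$$
   Context: Graphs are finite and undirected. For a simple graph $G$, the full-loop graph $\widehat G$ has one loop attached at every vertex. Line graph of a self-loop graph $G_S$: the vertices of $L(G_S)$ are the edges of $G_S$ (ordinary edges and loops); two distinct vertices of $L(G_S)$ are adjacent whenever the corresponding edges of $G_S$ have exactly one vertex in common (so the vertex corresponding to the loop at $v$ is adjacent precisely to the vertices corresponding to ordinary edges incident with $v$); and each vertex of $L(G_S)$ corresponding to a loop of $G_S$ itself carries one loop, while vertices corresponding to ordinary edges carry none. Thus $H=L(\widehat G)$ is a self-loop graph with $m+N$ vertices and $N$ loops. A self-loop graph $K_S$ is obtained from a simple graph $K$ on $\{1,\dots,n\}$ by attaching one loop at every vertex of $S$. For $|S|\ge1$, its Açıkmeşe lift is the simple graph on $\{1,\dots,2n+1\}$ such that: for each edge $\{i,j\}$ of $K$, both $\{i,j\}$ and $\{i+n+1,j+n+1\}$ are edges of the lift; for each $i\in S$, both $\{i,n+1\}$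 and $\{n+1,i+n+1\}$ are edges; there are no other edges. The involution matrix $T$ is the permutation matrix of the map swapping $i\leftrightarrow i+n+1$ ($1\le i\le n$) and fixing $n+1$. For the nontrivial element $g$ of $\mathbb{Z}_2$, the equivariant heat character of the lift $\widetilde H$ is $\chi_t^{\widetilde H}(g)=\mathrm{Tr}(e^{-t\mathcal{L}(\widetilde H)}T)$, $t>0$, where $\mathcal{L}(\widetilde H)=D(\widetilde H)-A(\widetilde H)$ is the ordinary Laplacian of $\widetilde H$. *)

(* Defs.v *)
From HB Require Import structures.
From mathcomp Require Import all_boot all_order all_fingroup all_algebra.
From mathcomp Require Import zify.
From mathcomp Require Import all_classical all_reals all_analysis.
Import Order.TTheory GRing.Theory Num.Theory.
Import numFieldNormedType.Exports.

Set Implicit Arguments.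
Unset Strict Implicit.
Unset Printing Implicit Defensive.

Local Open Scope nat_scope.

Record sgraph (V : finType) := SGraph {
  adj :> rel V;
  adj_sym : symmetric adj;
  adj_irr : irreflexive adj
}.

Definition deg (V : finType) (G : sgraph V) (x : V) : nat :=
  #|[set y | adj G x y]|.

Definition regular (V : finType) (G : sgraph V) (r : nat) : Prop :=
  forall x, deg G x = r.

(* A connected graph has at least one vertex. *)
Definition connected_graph (V : finType) (G : sgraph V) : Prop :=
  0 < #|V| /\ forall x y, connect (adj G) x y.

Definition edges (V : finType) (G : sgraph V) : {set {set V}} :=
  [set e | [exists x, exists y, adj G x y && (e == [set x; y])]].

Record slgraph (V : finType) := SLGraph {
  under : sgraph V;
  loops : {set V}
}.

Definition full_loop (V : finType) (G : sgraph V) : slgraph V :=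
  SLGraph G [set: V].

(* An ordinary edge xy is encoded by its vertex set [set x; y], a loop at v by
   [set v]; hence loops are the edges of cardinal 1. *)
Definition sl_edges (V : finType) (K : slgraph V) : {set {set V}} :=
  edges (under K) :|: [set [set v] | v in loops K].

Definition sl_edge (V : finType) (K : slgraph V) : finType :=
  {e : {set V} | e \in sl_edges K}.

Section LineGraph.
Variables (V : finType) (K : slgraph V).

Definition line_rel : rel (sl_edge K) :=
  fun e f => (e != f) && (#|val e :&: val f| == 1).

Lemma line_rel_sym : symmetric line_rel.
Proof. by move=> e f; rewrite /line_rel eq_sym finset.setIC. Qed.

Lemma line_rel_irr : irreflexive line_rel.
Proof. by move=> e; rewrite /line_rel eqxx. Qed.

Definition line_graph : slgraph (sl_edge K) :=
  SLGraph (SGraph line_rel_sym line_rel_irr) [set e : sl_edge K | #|val e| == 1].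

End LineGraph.

(* K transported along a labelling of its vertices (a bijection lab). *)
Section Relabel.
Variables (V W : finType) (lab : W -> V) (K : slgraph V).

Definition relabel_rel : rel W := fun i j => adj (under K) (lab i) (lab j).

Lemma relabel_rel_sym : symmetric relabel_rel.
Proof. by move=> i j; exact: adj_sym. Qed.

Lemma relabel_rel_irr : irreflexive relabel_rel.
Proof. by move=> i; exact: adj_irr. Qed.

Definition relabel : slgraph W :=
  SLGraph (SGraph relabel_rel_sym relabel_rel_irr)
    [set i : W | lab i \in loops K].

End Relabel.

(* Vertices are numbered from 0: i < n, the centre n, and i + n + 1 stand for
   the vertices i + 1, n + 1 and (i + 1) + n + 1 of {1, ..., 2n+1}. *)
Section Lift.
Variables (n : nat) (K : slgraph 'I_n).

Definition lift_arc (u v : 'I_(n.*2.+1)) : bool :=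
  [exists i : 'I_n, exists j : 'I_n, adj (under K) i j &&
     ((u == i :> nat) && (v == j :> nat)
      || (u == i + n.+1 :> nat) && (v == j + n.+1 :> nat))]
  || [exists i in loops K,
        (u == i :> nat) && (v == n :> nat)
        || (u == n :> nat) && (v == i + n.+1 :> nat)].

Definition lift_rel : rel 'I_(n.*2.+1) :=
  fun u v => lift_arc u v || lift_arc v u.

Lemma lift_rel_sym : symmetric lift_rel.
Proof. by move=> u v; rewrite /lift_rel orbC. Qed.

Lemma lift_rel_irr : irreflexive lift_rel.
Proof.
move=> u; rewrite /lift_rel orbb; apply/negP.
case/orP => [/existsP[i /existsP[j /andP[ij h]]]|/existsP[i /andP[_ h]]].
  suff: (i : nat) != j by move: h; lia.
  by apply/eqP => /val_inj eij; rewrite eij adj_irr in ij.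
by move: h; have := ltn_ord i; lia.
Qed.

Definition acikmese_lift : sgraph 'I_(n.*2.+1) :=
  SGraph lift_rel_sym lift_rel_irr.

End Lift.

Section Involution.
Variable n : nat.

Definition lift_swap (u : 'I_(n.*2.+1)) : 'I_(n.*2.+1) :=
  inord (if u < n then u + n.+1 else if n < u then u - n.+1 else u).

Lemma lift_swapE (u : 'I_(n.*2.+1)) : lift_swap u =
  (if u < n then u + n.+1 else if n < u then u - n.+1 else u) :> nat.
Proof.
by have := ltn_ord u; rewrite /lift_swap; case: (ltngtP u n) => h hu;
  rewrite inordK; lia.
Qed.

Lemma lift_swapK : involutive lift_swap.
Proof.
move=> u; apply: ord_inj; rewrite !lift_swapE; have := ltn_ord u.
case: (ltngtP u n) => h hu; last by rewrite h ltnn.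
- by case: ifP => ?; [lia | case: ifP => ?; lia].
- by case: ifP => ?; [lia | case: ifP => ?; lia].
Qed.

Definition lift_invol : {perm 'I_(n.*2.+1)} := perm (inv_inj lift_swapK).

End Involution.

Local Open Scope ring_scope.

Section Heat.
Variable R : realType.

Definition adj_mx n (G : sgraph 'I_n) : 'M[R]_n :=
  \matrix_(i, j) (adj G i j)%:R.

Definition deg_mx n (G : sgraph 'I_n) : 'M[R]_n :=
  diag_mx (\row_i (deg G i)%:R).

Definition laplacian n (G : sgraph 'I_n) : 'M[R]_n := deg_mx G - adj_mx G.

Definition mx_exp n (A : 'M[R]_n) : 'M[R]_n :=
  limn (series (fun k => (k`!%:R)^-1 *: (A ^+ k))).

Definition heat_character n (K : slgraph 'I_n) (t : R) : R :=
  \tr (mx_exp (- t *: laplacian (acikmese_lift K)) *m perm_mx (lift_invol n)).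

End Heat.

(* Main.v *)
Require Import Defs.
From HB Require Import structures.
From mathcomp Require Import all_boot all_order all_fingroup all_algebra.
From mathcomp Require Import ring zify.
From mathcomp Require Import all_classical all_reals all_analysis.
Import Order.TTheory GRing.Theory Num.Theory.
Import numFieldNormedType.Exports.
Set Implicit Arguments.
Unset Strict Implicit.
Unset Printing Implicit Defensive.
Local Open Scope ring_scope.

(** The lift consists of two copies (sheets) of the self-loop graph H, glued
    through a centre joined to the looped vertices of both sheets, and the
    involution exchanges the sheets. Since the Laplacian of the lift commutes
    with the involution, it acts separately on the even functions, determined
    by their values on one sheet and at the centre, and on the odd ones,
    determined by their values on one sheet and zero at the centre. On odd
    functions it is the matrix A = L(H) + diag(1_S), with S the set of looped
    vertices; on even functions it is A bordered by one row and one column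
    carried by 1_S. Hence Tr(L^k T) is the difference of the traces of the k-th
    powers of these two matrices ([trace_exp_fold], [fold_even_laplacian],
    [fold_odd_laplacian]).

    For the line graph of the full-loop graph of an r-regular graph, the split
    of the vertices into loops and ordinary edges is equitable: a loop is
    adjacent to no loop and to r edges, an edge to two loops. So A preserves
    the plane spanned by the indicators of the two classes, where its matrix is
    [r+1, -r; -2, 2]. The border lies in this plane, so the bordered matrix
    differs from A only there: away from the plane the traces cancel
    ([bordered_trace]), and Tr(L^k T) is the difference of the traces of the
    k-th powers of a 3x3 and a 2x2 matrix ([trace_exp_equitable]). The 3x3
    matrix has eigenvalues 0, eta^- and eta^+, the 2x2 one rho_1^- and
    rho_1^+; Cayley-Hamilton turns their power traces into linear recurrences,
    solved by the power sums of these numbers ([trace_even], [trace_odd]).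
    Summing over k against (-t)^k / k! gives the exponentials
    ([mxtrace_mx_exp]). *)

(** * Trace of a matrix exponential *)

Section MatrixExponential.
Local Open Scope classical_set_scope.

(** Registers matrices as a complete normed module, which is what makes the
    absolute convergence criterion for series applicable to them. *)
HB.instance Definition _ (R : realType) m n :=
  Uniform_isComplete.Build 'M[R]_(m, n) cauchy_cvg.

Lemma le_mx_norm (R : realType) m n (A : 'M[R]_(m, n)) i j : `|A i j| <= `|A|.
Proof.
rewrite [leRHS]/Num.norm /= mx_normrE; apply/bigmax_geP; right => /=.
by exists (i, j).
Qed.

(** The norm is the largest absolute value of an entry, so it is
    submultiplicative only up to the inner dimension. *)
Lemma mx_norm_mulmx (R : realType) m n p (A : 'M[R]_(m, n)) (B : 'M[R]_(n, p)) :
  `|A *m B| <= n%:R * (`|A| * `|B|).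
Proof.
rewrite [leLHS]/Num.norm /= mx_normrE; apply/bigmax_leP; split => [|[i j] _] /=.
  by rewrite !mulr_ge0.
rewrite mxE; apply: (le_trans (ler_norm_sum _ _ _)).
have -> : n%:R * (`|A| * `|B|) = \sum_(k < n) `|A| * `|B|.
  by rewrite sumr_const card_ord mulr_natl.
apply: ler_sum => k _.
by rewrite normrM ler_pM// le_mx_norm.
Qed.

Lemma mx_norm_exp (R : realType) n (A : 'M[R]_n) k :
  `|A ^+ k| <= `|(1%:M : 'M[R]_n)| * (n%:R * `|A|) ^+ k.
Proof.
elim: k => [|k IH]; first by rewrite !expr0 mulr1.
rewrite !exprS; apply: (le_trans (mx_norm_mulmx _ _)).
rewrite mulrA mulrCA ler_wpM2l// mulr_ge0//.
Qed.

(** The terms are dominated by those of the series of [expR (n * |A|)], up to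
    the norm of the identity. *)
Lemma cvg_mx_exp (R : realType) n (A : 'M[R]_n) :
  cvgn (series (fun k => (k`!%:R)^-1 *: (A ^+ k))).
Proof.
apply: normed_cvg.
set c : R := `|(1%:M : 'M[R]_n)|; set x : R := n%:R * `|A|.
apply: (@series_le_cvg _ _ (fun k => c * exp_coeff x k)) => [k|k|k|] /=.
- exact: normr_ge0.
- have x0 : 0 <= x by exact: mulr_ge0.
  by apply: mulr_ge0; [exact: normr_ge0 | exact: exp_coeff_ge0].
- rewrite normrZ ger0_norm ?invr_ge0// mulrC.
  rewrite [leRHS]mulrA ler_wpM2r ?invr_ge0//; exact: mx_norm_exp.
- have := @is_cvg_seriesZ _ _ c (is_cvg_series_exp_coeff x).
  by apply.
Qed.

Lemma mxtrace_mul_continuous (R : realType) n (P : 'M[R]_n) :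
  continuous (fun M : 'M[R]_n => \tr (M *m P)).
Proof.
have -> : (fun M : 'M[R]_n => \tr (M *m P)) =
    (fun M => \sum_i \sum_j M i j * P j i).
  by apply: boolp.funext => M; apply: eq_bigr => i _; rewrite mxE.
apply: (continuous_big (@add_continuous R)) => i _.
apply: (continuous_big (@add_continuous R)) => j _.
by move=> M; exact: (cvgM (@coord_continuous R n n i j M) (cvg_cst (P j i))).
Qed.

(** The trace against [P] is continuous, so it can be taken term by term in the
    exponential series; power sums then add up to exponentials of the numbers
    being powered. *)
Lemma mxtrace_mx_exp (R : realType) n (A P : 'M[R]_n) (s u : seq R) :
  (forall k, \tr (A ^+ k *m P) = \sum_(a <- s) a ^+ k - \sum_(b <- u) b ^+ k) ->
  \tr (mx_exp A *m P) = \sum_(a <- s) expR a - \sum_(b <- u) expR b.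
Proof.
move=> trA.
have cvg_expR (v : seq R) :
    (fun N => \sum_(a <- v) series (exp_coeff a) N) @ \oo -->
    \sum_(a <- v) expR a.
  apply: (cvg_big (@add_continuous R)) => a _.
  exact: is_cvg_series_exp_coeff.
have cvg_tr := @continuous_cvg _ _ _ \oo _ _ _ _
  (@mxtrace_mul_continuous R n P (mx_exp A)) (@cvg_mx_exp R n A).
rewrite -(cvg_lim (@Rhausdorff R) (cvg_tr _)).
apply: (cvg_lim (@Rhausdorff R)).
rewrite [X in X @ _](_ : _ = fun N => \sum_(a <- s) series (exp_coeff a) N
                                - \sum_(b <- u) series (exp_coeff b) N).
  exact: cvgB.
apply: boolp.funext => N; rewrite /= mulmx_suml raddf_sum /=.
rewrite [X in _ = X - _]exchange_big [X in _ = _ - X]exchange_big -sumrB.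
apply: eq_bigr => k _; rewrite -scalemxAl mxtraceZ trA mulrC mulrBl.
by rewrite !mulr_suml.
Qed.

End MatrixExponential.

Lemma scalemx_exp (R : comPzRingType) n (x : R) (A : 'M[R]_n) k :
  (x *: A) ^+ k = x ^+ k *: A ^+ k.
Proof.
elim: k => [|k IH]; first by rewrite !expr0 scale1r.
by rewrite !exprS IH -[LHS]/(_ *m _) -scalemxAl -scalemxAr scalerA.
Qed.

(** * Even and odd functions on the lift *)

Section Sheets.
Variable n : nat.
Implicit Types (i j : 'I_n) (u v : 'I_(n.*2.+1)).

(** [lower i] and [upper i] are the two copies of the vertex [i]. *)
Definition lower i : 'I_(n.*2.+1) := inord i.
Definition center : 'I_(n.*2.+1) := inord n.
Definition upper i : 'I_(n.*2.+1) := inord (i + n.+1).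

Lemma lowerE i : lower i = i :> nat.
Proof. by rewrite inordK //; have := ltn_ord i; lia. Qed.

Lemma centerE : center = n :> nat.
Proof. by rewrite inordK //; lia. Qed.

Lemma upperE i : upper i = (i + n.+1)%N :> nat.
Proof. by rewrite inordK //; have := ltn_ord i; lia. Qed.

Lemma swap_lower i : lift_swap (lower i) = upper i.
Proof. by apply: ord_inj; rewrite lift_swapE lowerE upperE ltn_ord. Qed.

Lemma swap_center : lift_swap center = center.
Proof. by apply: ord_inj; rewrite lift_swapE centerE ltnn. Qed.

Lemma swap_upper i : lift_swap (upper i) = lower i.
Proof. by rewrite -swap_lower lift_swapK. Qed.

Lemma sum_sheets (U : nmodType) (F : 'I_(n.*2.+1) -> U) :
  \sum_u F u = \sum_i F (lower i) + F center + \sum_i F (upper i).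
Proof.
have size_eq : (n + (1 + n) = n.*2.+1)%N by lia.
rewrite (reindex (cast_ord size_eq)) /=; last first.
  by apply: onW_bij; exists (cast_ord (esym size_eq)) => i; apply: ord_inj.
rewrite !big_split_ord big_ord1 /= addrA.
congr (_ + _ + _); [apply: eq_bigr => i _| |apply: eq_bigr => i _];
  congr F; apply: ord_inj => /=; rewrite ?lowerE ?centerE ?upperE; lia.
Qed.

Lemma sheetsP (P : 'I_(n.*2.+1) -> Prop) :
  (forall i, P (lower i)) -> P center -> (forall i, P (upper i)) ->
  forall u, P u.
Proof.
move=> Plo Pc Pup u; have u_lt := ltn_ord u.
case: (ltngtP u n) => hu.
- have -> : u = lower (Ordinal hu) by apply: ord_inj; rewrite lowerE.
  exact: Plo.
- have hu' : (u - n.+1 < n)%N by lia.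
  have -> : u = upper (Ordinal hu') by apply: ord_inj; rewrite upperE /=; lia.
  exact: Pup.
- by have -> : u = center by apply: ord_inj; rewrite centerE.
Qed.

End Sheets.

Section Folding.
Variables (R : comNzRingType) (n : nat).
Implicit Types (X Y : 'M[R]_(n.*2.+1)) (i j : 'I_n).

Definition swap_invariant X :=
  forall u v, X (lift_swap u) (lift_swap v) = X u v.

(** The action of [X] on odd functions, in the coordinates given by the values
    on the lower sheet. *)
Definition fold_odd X : 'M[R]_n :=
  \matrix_(i, j) (X (lower i) (lower j) - X (lower i) (upper j)).

(** The action of [X] on even functions, in the coordinates given by the values
    on the lower sheet and at the centre. The factor 2 in the last row is there
    because the centre sees both sheets. *)
Definition fold_even X : 'M[R]_(n + 1) :=
  block_mx (\matrix_(i, j) (X (lower i) (lower j) + X (lower i) (upper j)))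
           (\col_i X (lower i) (center n))
           (\row_j (2 * X (center n) (lower j)))
           (X (center n) (center n))%:M.

Lemma swap_invariantE X : swap_invariant X ->
  (forall i j, X (upper i) (upper j) = X (lower i) (lower j)) *
  (forall i j, X (upper i) (lower j) = X (lower i) (upper j)) *
  (forall i, X (upper i) (center n) = X (lower i) (center n)) *
  (forall j, X (center n) (upper j) = X (center n) (lower j)).
Proof.
move=> invX; do ![split]; move=> *;
  by rewrite -invX ?swap_upper ?swap_lower ?swap_center.
Qed.

Lemma swap_invariant1 : swap_invariant 1%:M.
Proof. by move=> u v; rewrite !mxE (inj_eq (inv_inj (@lift_swapK n))). Qed.

Lemma swap_invariantM X Y :
  swap_invariant X -> swap_invariant Y -> swap_invariant (X *m Y).
Proof.
move=> invX invY u v; rewrite !mxE (reindex_inj (inv_inj (@lift_swapK n))) /=.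
by apply: eq_bigr => w _; rewrite invX invY.
Qed.

Lemma fold_oddM X Y : swap_invariant Y ->
  fold_odd (X *m Y) = fold_odd X *m fold_odd Y.
Proof.
move=> /swap_invariantE invY; apply/matrixP => i j.
rewrite !mxE -sumrB sum_sheets !invY subrr addr0 -big_split.
by apply: eq_bigr => k _; rewrite /= !mxE !invY; ring.
Qed.

Lemma fold_evenM X Y : swap_invariant X -> swap_invariant Y ->
  fold_even (X *m Y) = fold_even X *m fold_even Y.
Proof.
move=> /swap_invariantE invX /swap_invariantE invY; rewrite mulmx_block.
congr block_mx; apply/matrixP => i j.
- rewrite !mxE big_ord1 -big_split sum_sheets /= !mxE !invY addrAC -big_split.
  congr (_ + _); last by ring.
  by apply: eq_bigr => k _; rewrite /= !mxE !invY; ring.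
- rewrite !mxE sum_sheets big_ord1 !mxE addrAC -big_split ord1 eqxx.
  congr (_ + _); apply: eq_bigr => k _.
  by rewrite /= !mxE !invY; ring.
- rewrite !mxE sum_sheets big_ord1 !mxE ord1 eqxx mulr1n.
  rewrite addrAC -big_split mulrDr mulr_sumr; congr (_ + _); last by ring.
  by apply: eq_bigr => k _; rewrite /= !mxE !invX !invY; ring.
- rewrite !mxE sum_sheets big_ord1 !mxE !ord1 eqxx !mulr1n.
  rewrite addrAC -big_split; congr (_ + _).
  by apply: eq_bigr => k _; rewrite /= !mxE !invX !invY; ring.
Qed.

(** The involution is 1 on even functions and -1 on odd ones. *)
Lemma trace_fold X : swap_invariant X ->
  \tr (X *m perm_mx (lift_invol n)) = \tr (fold_even X) - \tr (fold_odd X).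
Proof.
move=> /swap_invariantE invX; rewrite mxtrace_mulC -row_permE.
rewrite mxtrace_block mxtrace_scalar /mxtrace sum_sheets !mxE !permE.
rewrite swap_center [LHS]addrAC -big_split [RHS]addrAC -sumrB; congr (_ + _).
apply: eq_bigr => i _.
by rewrite /= !mxE !permE swap_lower swap_upper !invX; ring.
Qed.

Lemma fold1 : fold_even 1%:M = 1%:M /\ fold_odd 1%:M = 1%:M.
Proof.
have lo_neq i : (lower i == center n) = false.
  by rewrite -val_eqE /= lowerE centerE; have := ltn_ord i; lia.
have lo_up i j : (lower i == upper j) = false.
  by rewrite -val_eqE /= lowerE upperE; have := ltn_ord i; lia.
have lo_lo i j : (lower i == lower j) = (i == j).
  by rewrite -!val_eqE /= !lowerE.
split; last by apply/matrixP => i j; rewrite !mxE lo_up lo_lo subr0.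
rewrite scalar_mx_block; congr block_mx; apply/matrixP => i j; rewrite !mxE.
- by rewrite lo_up lo_lo addr0.
- by rewrite lo_neq.
- by rewrite eq_sym lo_neq mulr0.
- by rewrite eqxx.
Qed.

Lemma fold_exp X k : swap_invariant X ->
  [/\ swap_invariant (X ^+ k), fold_even (X ^+ k) = fold_even X ^+ k &
      fold_odd (X ^+ k) = fold_odd X ^+ k].
Proof.
move=> invX; elim: k => [|k [invXk IHs IHa]].
  by rewrite !expr0; split; [exact: swap_invariant1 | case: fold1 ..].
rewrite !exprS; split; first exact: swap_invariantM.
- by rewrite fold_evenM // IHs.
- by rewrite fold_oddM // IHa.
Qed.

Lemma trace_exp_fold X k : swap_invariant X ->
  \tr (X ^+ k *m perm_mx (lift_invol n))
  = \tr (fold_even X ^+ k) - \tr (fold_odd X ^+ k).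
Proof. by move=> /(fold_exp k)[invXk <- <-]; exact: trace_fold. Qed.

End Folding.

(** * The Laplacian of the lift *)

Section LiftAdjacency.
Variables (n : nat) (K : slgraph 'I_n).
Implicit Types i j : 'I_n.

Lemma lift_arc_lower i j : lift_arc K (lower i) (lower j) = adj (under K) i j.
Proof.
apply/idP/idP => [/orP[]|ij].
- case/existsP => i' /existsP[j' /andP[ij' h]].
  have [ei ej] : i = i' :> nat /\ j = j' :> nat.
    by move: h (ltn_ord i) (ltn_ord j); rewrite !lowerE; lia.
  by rewrite (ord_inj ei) (ord_inj ej).
- case/existsP => i' /andP[_].
  by rewrite !lowerE; have := ltn_ord i; have := ltn_ord j; lia.
- apply/orP; left; apply/existsP; exists i; apply/existsP; exists j.
  by rewrite ij !lowerE !eqxx.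
Qed.

Lemma lift_lower i j :
  adj (acikmese_lift K) (lower i) (lower j) = adj (under K) i j.
Proof.
by rewrite /= /lift_rel !lift_arc_lower [adj _ j i]adj_sym orbb.
Qed.

Lemma lift_upper i j :
  adj (acikmese_lift K) (upper i) (upper j) = adj (under K) i j.
Proof.
have arc i' j' : lift_arc K (upper i') (upper j') = adj (under K) i' j'.
  apply/idP/idP => [/orP[]|ij].
  - case/existsP => i1 /existsP[j1 /andP[ij1 h]].
    have [ei ej] : i' = i1 :> nat /\ j' = j1 :> nat.
      by move: h (ltn_ord i1) (ltn_ord j1); rewrite !upperE; lia.
    by rewrite (ord_inj ei) (ord_inj ej).
  - case/existsP => i1 /andP[_].
    by rewrite !upperE; have := ltn_ord i1; lia.
  - apply/orP; left; apply/existsP; exists i'; apply/existsP; exists j'.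
    by rewrite ij !upperE !eqxx orbT.
by rewrite /= /lift_rel !arc [adj _ j i]adj_sym orbb.
Qed.

Lemma lift_lower_upper i j : adj (acikmese_lift K) (lower i) (upper j) = false.
Proof.
apply/negP => /orP[] /orP[].
- case/existsP => i1 /existsP[j1 /andP[_]].
  by rewrite lowerE upperE; move: (ltn_ord i) (ltn_ord i1) (ltn_ord j1); lia.
- case/existsP => i1 /andP[_].
  by rewrite lowerE upperE; move: (ltn_ord i) (ltn_ord i1); lia.
- case/existsP => i1 /existsP[j1 /andP[_]].
  by rewrite lowerE upperE; move: (ltn_ord i) (ltn_ord i1) (ltn_ord j1); lia.
- case/existsP => i1 /andP[_].
  by rewrite lowerE upperE; move: (ltn_ord i) (ltn_ord i1); lia.
Qed.

Lemma lift_lower_center i :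
  adj (acikmese_lift K) (lower i) (center n) = (i \in loops K).
Proof.
apply/idP/idP => [/orP[] /orP[]|iS].
- case/existsP => i1 /existsP[j1 /andP[_]].
  by rewrite lowerE centerE; move: (ltn_ord i) (ltn_ord i1) (ltn_ord j1); lia.
- case/existsP => i1 /andP[i1S h].
  have ei : i = i1 :> nat.
    by move: h (ltn_ord i) (ltn_ord i1); rewrite lowerE centerE; lia.
  by rewrite (ord_inj ei).
- case/existsP => i1 /existsP[j1 /andP[_]].
  by rewrite lowerE centerE; move: (ltn_ord i) (ltn_ord i1) (ltn_ord j1); lia.
- case/existsP => i1 /andP[_].
  by rewrite lowerE centerE; move: (ltn_ord i) (ltn_ord i1); lia.
- apply/orP; left; apply/orP; right; apply/existsP; exists i.
  by rewrite iS lowerE centerE !eqxx.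
Qed.

Lemma lift_upper_center i :
  adj (acikmese_lift K) (upper i) (center n) = (i \in loops K).
Proof.
apply/idP/idP => [/orP[] /orP[]|iS].
- case/existsP => i1 /existsP[j1 /andP[_]].
  by rewrite upperE centerE; move: (ltn_ord i) (ltn_ord i1) (ltn_ord j1); lia.
- case/existsP => i1 /andP[i1S h].
  by move: h (ltn_ord i) (ltn_ord i1); rewrite upperE centerE; lia.
- case/existsP => i1 /existsP[j1 /andP[_]].
  by rewrite upperE centerE; move: (ltn_ord i) (ltn_ord i1) (ltn_ord j1); lia.
- case/existsP => i1 /andP[i1S].
  rewrite upperE centerE => h.
  have ei : i = i1 :> nat.
    by move: h (ltn_ord i) (ltn_ord i1); lia.
  by rewrite (ord_inj ei).
- apply/orP; right; apply/orP; right; apply/existsP; exists i.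
  by rewrite iS upperE centerE !eqxx orbT.
Qed.

Definition liftE := (lift_lower, lift_upper, lift_lower_upper,
  lift_lower_center, lift_upper_center, adj_irr).

Lemma lift_swap_adj u v : adj (acikmese_lift K) (lift_swap u) (lift_swap v)
  = adj (acikmese_lift K) u v.
Proof.
elim/sheetsP: u => [i||i]; elim/sheetsP: v => [j||j];
  rewrite ?swap_lower ?swap_upper ?swap_center ?liftE //;
  by rewrite adj_sym ?liftE // [RHS]adj_sym liftE.
Qed.

End LiftAdjacency.

(* Keeps [/=] from unfolding the adjacency of the lift, on which the rewriting
   rules above are keyed. *)
#[local] Arguments adj : simpl never.

Section FoldedLaplacian.
Variables (R : realType) (n : nat) (K : slgraph 'I_n).
Implicit Types i j : 'I_n.

Lemma natr_deg (V : finType) (G : sgraph V) (x : V) :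
  (deg G x)%:R = \sum_y (adj G x y)%:R :> R.
Proof.
rewrite /deg -sum1_card natr_sum big_mkcond /=.
by apply: eq_bigr => y _; rewrite inE; case: ifP.
Qed.

Lemma laplacian_lift_invariant :
  swap_invariant (laplacian R (acikmese_lift K)).
Proof.
move=> u v; rewrite !mxE lift_swap_adj !natr_deg.
rewrite (inj_eq (inv_inj (@lift_swapK n))).
rewrite (reindex_inj (inv_inj (@lift_swapK n))); congr (_ *+ _ - _).
by apply: eq_bigr => w _; rewrite lift_swap_adj.
Qed.

(** A loop adds 1 to the diagonal, since it becomes an edge to the centre, where
    odd functions vanish. *)
Definition loop_laplacian : 'M[R]_n := \matrix_(i, j)
  ((\sum_k (adj (under K) i k)%:R + (i \in loops K)%:R) *+ (i == j)
   - (adj (under K) i j)%:R).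

Definition loop_col : 'cV[R]_n := \col_i (i \in loops K)%:R.

Lemma laplacian_lift_lower i j :
  laplacian R (acikmese_lift K) (lower i) (lower j) = loop_laplacian i j.
Proof.
rewrite !mxE lift_lower natr_deg sum_sheets -!val_eqE /= !lowerE.
congr (_ *+ _ - _).
rewrite [X in _ + X]big1 ?addr0 => [|k _]; last by rewrite lift_lower_upper.
rewrite lift_lower_center; congr (_ + _).
by apply: eq_bigr => k _; rewrite lift_lower.
Qed.

Lemma laplacian_lift_lower_upper i j :
  laplacian R (acikmese_lift K) (lower i) (upper j) = 0.
Proof.
rewrite !mxE lift_lower_upper -val_eqE /= lowerE upperE subr0.
suff -> : (i == (j + n.+1)%N :> nat) = false by rewrite mulr0n.
by have := ltn_ord i; lia.
Qed.

Lemma fold_odd_laplacian :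
  fold_odd (laplacian R (acikmese_lift K)) = loop_laplacian.
Proof.
apply/matrixP => i j; rewrite [LHS]mxE laplacian_lift_lower.
by rewrite laplacian_lift_lower_upper subr0.
Qed.

Lemma fold_even_laplacian :
  fold_even (laplacian R (acikmese_lift K)) =
  block_mx loop_laplacian (- loop_col) (- 2 *: loop_col^T)
           (2 * #|loops K|%:R)%:M.
Proof.
congr block_mx; apply/matrixP => i j; rewrite [LHS]mxE.
- by rewrite laplacian_lift_lower laplacian_lift_lower_upper addr0.
- rewrite !mxE lift_lower_center -val_eqE /= lowerE centerE.
  by rewrite (ltn_eqF (ltn_ord i)) sub0r.
- rewrite !mxE adj_sym lift_lower_center -val_eqE /= lowerE centerE.
  by rewrite (gtn_eqF (ltn_ord j)) sub0r mulrN mulNr.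
- rewrite [RHS]mxE; congr (_ *+ _); rewrite !mxE eqxx adj_irr subr0 mulr1n.
  have -> : #|loops K|%:R = \sum_k (k \in loops K)%:R :> R.
    rewrite -sum1_card natr_sum big_mkcond /=.
    by apply: eq_bigr => k _; case: ifP.
  rewrite natr_deg sum_sheets adj_irr addr0 mulr2n mulrDl !mul1r.
  by congr (_ + _); apply: eq_bigr => k _; rewrite adj_sym liftE.
Qed.

Lemma trace_exp_laplacian_lift k :
  \tr (laplacian R (acikmese_lift K) ^+ k *m perm_mx (lift_invol n)) =
  \tr (block_mx loop_laplacian (- loop_col) (- 2 *: loop_col^T)
         (2 * #|loops K|%:R)%:M ^+ k) - \tr (loop_laplacian ^+ k).
Proof.
rewrite trace_exp_fold; last exact: laplacian_lift_invariant.
by rewrite fold_even_laplacian fold_odd_laplacian.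
Qed.

End FoldedLaplacian.

(** * Power traces of bordered matrices *)

Section BorderedTrace.
Variables (R : comNzRingType) (n p q : nat).
Variables (A : 'M[R]_n) (M : 'M[R]_p) (P : 'M[R]_(n, p)) (Q : 'M[R]_(p, n)).
Variables (c : 'M[R]_(p, q)) (w : 'M[R]_(q, p)) (d : 'M[R]_q).
Hypotheses (QA : Q *m A = M *m Q) (AP : A *m P = P *m M) (QP : Q *m P = 1%:M).

Lemma intertwine_exp k : Q *m A ^+ k = M ^+ k *m Q.
Proof.
elim: k => [|k IH]; first by rewrite !expr0 mulmx1 mul1mx.
by rewrite !exprSr mulmxA IH -mulmxA QA mulmxA.
Qed.

(** The image of [P] is stable under [A], which acts on it as [M]; with the
    border coordinates added, it is stable under the bordered matrix, which
    acts there as the small bordered one. Modulo these subspaces both matrices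
    act in the same way, so their powers differ by a correction that factors
    through [P] and [Q], read off from the powers of the small matrices. *)
Lemma bordered_exp k : exists Z x y z,
  block_mx M c w d ^+ k = block_mx Z y x z /\
  block_mx A (P *m c) (w *m Q) d ^+ k
    = block_mx (A ^+ k + P *m (Z - M ^+ k) *m Q) (P *m y) (x *m Q) z.
Proof.
elim: k => [|k [Z [x [y [z [E1 E2]]]]]].
  exists 1%:M, 0, 0, 1%:M; rewrite !expr0 subrr !mulmx0 !mul0mx addr0.
  by rewrite -!scalar_mx_block.
(* The blocks of the next power of the small matrix. *)
exists (M *m Z + c *m x), (w *m Z + d *m x).
exists (M *m y + c *m z), (w *m y + d *m z).
rewrite !exprS E1 E2; split; rewrite [LHS]mulmx_block //; congr block_mx.
- rewrite (mulmxDr A) -[in LHS]addrA; congr (_ + _).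
  rewrite !mulmxA AP -[LHS]mulmxDl; congr (_ *m Q).
  rewrite -!mulmxA -mulmxDr; congr (P *m _).
  by rewrite mulmxBr addrAC.
- by rewrite mulmxDr !mulmxA AP.
- rewrite -mulmxA (mulmxDr Q) intertwine_exp [Q *m (P *m _ *m _)]mulmxA.
  rewrite (mulmxA Q) QP mul1mx -(mulmxDl (M ^+ k)) [M ^+ k + _]addrC subrK.
  by rewrite !mulmxA -mulmxDl.
- by rewrite -mulmxA (mulmxA Q) QP mul1mx.
Qed.

Lemma bordered_trace k :
  \tr (block_mx A (P *m c) (w *m Q) d ^+ k) - \tr (A ^+ k)
  = \tr (block_mx M c w d ^+ k) - \tr (M ^+ k).
Proof.
have [Z [x [y [z [-> ->]]]]] := bordered_exp k.
rewrite !mxtrace_block mxtraceD -mulmxA mxtrace_mulC -mulmxA QP mulmx1.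
by rewrite raddfB /=; ring.
Qed.

End BorderedTrace.

Lemma recurrence2_eq (R : nzRingType) (t d : R) (u v : nat -> R) :
  (forall k, u k.+2 = t * u k.+1 - d * u k) ->
  (forall k, v k.+2 = t * v k.+1 - d * v k) ->
  u 0%N = v 0%N -> u 1%N = v 1%N -> u =1 v.
Proof.
move=> Hu Hv e0 e1 k; suff [] : u k = v k /\ u k.+1 = v k.+1 by [].
by elim: k => // k [IH1 IH2]; rewrite Hu Hv IH1 IH2.
Qed.

(** The trace of a power obeys the recurrence of the characteristic polynomial,
    as the power sum of its roots does. *)
Lemma trace_exp2 (R : comNzRingType) (M : 'M[R]_2) (a b : R) k :
  M ^+ 2 = (a + b) *: M - (a * b)%:M -> \tr M = a + b ->
  \tr (M ^+ k) = a ^+ k + b ^+ k.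
Proof.
move=> HM trM; move: k.
apply: (@recurrence2_eq _ (a + b) (a * b)) => [k|k||].
- rewrite -[k.+2]addn2 exprD HM.
  rewrite -[_ * _]/(_ *m _) mulmxBr -scalemxAr mul_mx_scalar.
  rewrite raddfB /= !mxtraceZ.
  by rewrite -[_ *m _]/(_ * M) -exprSr.
- by rewrite !exprSr; ring.
- by rewrite !expr0 mxtrace1.
- by rewrite !expr1.
Qed.

(** The same for a third eigenvalue equal to 0, where the recurrence of order
    two starts at the first power. *)
Lemma trace_exp3 (R : comNzRingType) (M : 'M[R]_3) (a b : R) k :
  M ^+ 3 = (a + b) *: M ^+ 2 - (a * b) *: M -> \tr M = a + b ->
  \tr (M ^+ 2) = a ^+ 2 + b ^+ 2 ->
  \tr (M ^+ k) = 0 ^+ k + a ^+ k + b ^+ k.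
Proof.
move=> HM trM trM2; case: k => [|k].
  by rewrite !expr0 mxtrace1; ring.
rewrite expr0n /= add0r; move: k.
apply: (@recurrence2_eq _ (a + b) (a * b)) => [k|k||].
- rewrite -[k.+3]addn3 exprD HM mulrBr -!scalerAr -exprSr -exprD addn2.
  by rewrite raddfB /= !mxtraceZ.
- by rewrite !exprSr; ring.
- by rewrite !expr1.
- by [].
Qed.

Section SmallMatrices.
Variable R : comNzRingType.

(** Row-major 2x2 and 3x3 matrices in nested block form, which is the shape in
    which [bordered_trace] produces them. *)
Definition mx2 (a b c d : R) : 'M[R]_(1 + 1) := block_mx a%:M b%:M c%:M d%:M.

Definition mx3 (a b c d e f g h k : R) : 'M[R]_(1 + 1 + 1) :=
  block_mx (mx2 a b d e) (col_mx c%:M f%:M) (row_mx g%:M h%:M) k%:M.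

Lemma mul_mx2 a b c d a' b' c' d' :
  mx2 a b c d *m mx2 a' b' c' d' =
  mx2 (a * a' + b * c') (a * b' + b * d') (c * a' + d * c') (c * b' + d * d').
Proof. by rewrite mulmx_block -!scalar_mxM -!raddfD. Qed.

Lemma mul_mx3 a b c d e f g h k a' b' c' d' e' f' g' h' k' :
  mx3 a b c d e f g h k *m mx3 a' b' c' d' e' f' g' h' k' =
  mx3 (a * a' + b * d' + c * g') (a * b' + b * e' + c * h')
      (a * c' + b * f' + c * k')
      (d * a' + e * d' + f * g') (d * b' + e * e' + f * h')
      (d * c' + e * f' + f * k')
      (g * a' + h * d' + k * g') (g * b' + h * e' + k * h')
      (g * c' + h * f' + k * k').
Proof.
rewrite mulmx_block mul_mx2 mul_col_row mul_block_col mul_row_block.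
rewrite mul_row_col mul_col_mx mul_mx_row -!scalar_mxM.
by rewrite add_block_mx add_col_mx add_row_mx -!raddfD.
Qed.

Lemma mxtrace_mx2 a b c d : \tr (mx2 a b c d) = a + d.
Proof. by rewrite mxtrace_block !mxtrace_scalar. Qed.

Lemma mxtrace_mx3 a b c d e f g h k : \tr (mx3 a b c d e f g h k) = a + e + k.
Proof. by rewrite mxtrace_block mxtrace_mx2 mxtrace_scalar. Qed.

Lemma scale_mx2 x a b c d :
  x *: mx2 a b c d = mx2 (x * a) (x * b) (x * c) (x * d).
Proof. by rewrite scale_block_mx !scale_scalar_mx. Qed.

Lemma scale_mx3 x a b c d e f g h k : x *: mx3 a b c d e f g h k =
  mx3 (x * a) (x * b) (x * c) (x * d) (x * e) (x * f) (x * g) (x * h) (x * k).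
Proof.
by rewrite scale_block_mx scale_mx2 scale_col_mx scale_row_mx !scale_scalar_mx.
Qed.

Lemma sub_mx2 a b c d a' b' c' d' : mx2 a b c d - mx2 a' b' c' d' =
  mx2 (a - a') (b - b') (c - c') (d - d').
Proof. by rewrite opp_block_mx add_block_mx -!raddfB. Qed.

Lemma sub_mx3 a b c d e f g h k a' b' c' d' e' f' g' h' k' :
  mx3 a b c d e f g h k - mx3 a' b' c' d' e' f' g' h' k' =
  mx3 (a - a') (b - b') (c - c') (d - d') (e - e') (f - f')
      (g - g') (h - h') (k - k').
Proof.
rewrite opp_block_mx add_block_mx sub_mx2 opp_col_mx add_col_mx.
by rewrite opp_row_mx add_row_mx -!raddfB.
Qed.

Lemma trace_odd (a b x : R) k :
  a + b = x + 3 -> a * b = 2 ->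
  \tr (mx2 (x + 1) (- x) (- 2) 2 ^+ k) = a ^+ k + b ^+ k.
Proof.
move=> s p; apply: trace_exp2; last by rewrite mxtrace_mx2 s; ring.
rewrite expr2 -[_ * _]/(_ *m _) mul_mx2 s p.
have -> : (2%:M : 'M[R]_(1 + 1)) = mx2 2 0 0 2.
  by rewrite scalar_mx_block /mx2 raddf0.
by rewrite scale_mx2 sub_mx2; congr mx2; ring.
Qed.

(** Every row sums to 0, so the constant vector is in the kernel; [a] and [b]
    are the roots of the remaining quadratic factor of the characteristic
    polynomial. *)
Lemma trace_even (a b x y : R) k :
  a + b = 2 * y + x + 3 -> a * b = 2 * y * x + 4 * y + 2 ->
  \tr (mx3 (x + 1) (- x) (- 1) (- 2) 2 0 (- 2 * y) 0 (2 * y) ^+ k)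
  = 0 ^+ k + a ^+ k + b ^+ k.
Proof.
move=> s p; apply: trace_exp3.
- set M := mx3 _ _ _ _ _ _ _ _ _.
  have -> : M ^+ 2 = M *m M by rewrite expr2.
  have -> : M ^+ 3 = M *m (M *m M) by rewrite exprS expr2.
  by rewrite /M !mul_mx3 !scale_mx3 sub_mx3 s p; congr mx3; ring.
- by rewrite mxtrace_mx3 s; ring.
- have -> : a ^+ 2 + b ^+ 2 = (a + b) ^+ 2 - 2 * (a * b) by ring.
  by rewrite expr2 -[_ * _]/(_ *m _) mul_mx3 mxtrace_mx3 s p; ring.
Qed.

End SmallMatrices.

(** * Self-loop graphs with an equitable set of loops *)

Section EquitableLoops.
Variables (R : realType) (n r : nat) (K : slgraph 'I_n).
Hypothesis loop_loop : forall i j,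
  i \in loops K -> j \in loops K -> adj (under K) i j = false.
Hypothesis loop_deg : forall i, i \in loops K -> deg (under K) i = r.
Hypothesis loops_at : forall i, i \notin loops K ->
  #|[set j in loops K | adj (under K) i j]%SET| = 2%N.

Let A := loop_laplacian R K.
Let s := loop_col R K.
Definition nonloop_col : 'cV[R]_n := const_mx 1 - s.
Let e := nonloop_col.

Lemma loop_laplacian_sym : A^T = A.
Proof.
apply/matrixP => i j; rewrite !mxE adj_sym eq_sym.
by case: eqVneq => [->|].
Qed.

(** Constants lie in the kernel of the Laplacian, so only the loops remain. *)
Lemma loop_laplacian_const : A *m const_mx 1 = s.
Proof.
apply/colP => i; rewrite !mxE.
under eq_bigr do rewrite !mxE mulr1.
rewrite sumrB (bigD1 i) //= eqxx mulr1n [X in _ + X - _]big1 => [|j ji].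
  by rewrite addr0 addrAC subrr add0r.
by rewrite eq_sym (negPf ji).
Qed.

Lemma loop_laplacian_loops : A *m s = (r%:R + 1) *: s - 2 *: e.
Proof.
apply/colP => i; rewrite !mxE.
under eq_bigr do rewrite !mxE mulrBl.
rewrite sumrB (bigD1 i) //= eqxx mulr1n.
rewrite [X in _ + X - _]big1 ?addr0 => [|j ji]; last first.
  by rewrite eq_sym (negPf ji) mul0r.
have [iS|iS] := boolP (i \in loops K).
  rewrite -natr_deg loop_deg // [X in _ - X]big1 => [|j _]; last first.
    case: (boolP (j \in loops K)) => [jS|_]; last by rewrite mulr0.
    by rewrite loop_loop // mul0r.
  by rewrite subrr mulr0 !subr0.
have -> : \sum_j (adj (under K) i j)%:R * (j \in loops K)%:R = 2 :> R.
  rewrite -[RHS]/(2%:R) -(loops_at iS) -sum1_card natr_sum [RHS]big_mkcond /=.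
  apply: eq_bigr => j _; rewrite inE -natrM mulnb andbC.
  by case: ifP.
by rewrite !mulr0 subr0 mulr1.
Qed.

Lemma loop_laplacian_nonloops : A *m e = - r%:R *: s + 2 *: e.
Proof.
rewrite mulmxBr loop_laplacian_const loop_laplacian_loops.
by apply/colP => i; rewrite !mxE; ring.
Qed.

Lemma nonloop_colE i : e i 0 = (i \notin loops K)%:R.
Proof. by rewrite !mxE; case: (i \in loops K); rewrite ?subrr ?subr0. Qed.

Lemma dot_loops : s^T *m s = #|loops K|%:R%:M.
Proof.
apply/matrixP => i j; rewrite !ord1 !mxE eqxx mulr1n -sum1_card natr_sum.
rewrite [RHS]big_mkcond; apply: eq_bigr => k _; rewrite !mxE.
by case: (k \in loops K); rewrite ?mulr1 ?mulr0.
Qed.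

Lemma dot_nonloops : e^T *m e = #|~: loops K|%:R%:M.
Proof.
apply/matrixP => i j; rewrite !ord1 !mxE eqxx mulr1n -sum1_card natr_sum.
rewrite [RHS]big_mkcond; apply: eq_bigr => k _.
rewrite [e^T _ _]mxE nonloop_colE !inE.
by case: (k \in loops K); rewrite ?mulr1 ?mulr0.
Qed.

Lemma dot_loops_nonloops : s^T *m e = 0.
Proof.
apply/matrixP => i j; rewrite !ord1 !mxE; apply: big1 => k _.
rewrite nonloop_colE !mxE.
by case: (k \in loops K); rewrite ?mulr0 ?mul0r.
Qed.

Lemma dot_nonloops_loops : e^T *m s = 0.
Proof. by rewrite -[LHS]trmxK trmx_mul trmxK dot_loops_nonloops trmx0. Qed.

(** [2 * m = N * r] counts the pairs of a loop and an edge adjacent to it. It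
    makes the normalised indicators intertwine [A] from the left with the same
    2x2 matrix as the indicators do from the right. *)
Lemma trace_exp_equitable k :
  let N := #|loops K|%:R in let m := #|~: loops K|%:R in
  N != 0 -> m != 0 -> 2 * m = N * r%:R ->
  \tr (laplacian R (acikmese_lift K) ^+ k *m perm_mx (lift_invol n)) =
  \tr (mx3 (r%:R + 1) (- r%:R) (- 1) (- 2) 2 0 (- 2 * N) 0 (2 * N) ^+ k)
  - \tr (mx2 (r%:R + 1 : R) (- r%:R) (- 2) 2 ^+ k).
Proof.
move=> N m N0 m0 mN; rewrite trace_exp_laplacian_lift.
pose P := row_mx s e; pose Q := col_mx (N^-1 *: s^T) (m^-1 *: e^T).
have AT (x : 'cV[R]_n) : x^T *m A = (A *m x)^T.
  by rewrite trmx_mul loop_laplacian_sym.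
have AP : A *m P = P *m mx2 (r%:R + 1 : R) (- r%:R) (- 2) 2.
  rewrite mul_mx_row mul_row_block !mul_mx_scalar.
  by rewrite loop_laplacian_loops loop_laplacian_nonloops !scaleNr.
have QP : Q *m P = 1%:M.
  rewrite mul_col_row -!scalemxAl dot_loops dot_nonloops.
  rewrite dot_loops_nonloops dot_nonloops_loops !scaler0 !scale_scalar_mx.
  by rewrite !mulVf // -scalar_mx_block.
have QA : Q *m A = mx2 (r%:R + 1 : R) (- r%:R) (- 2) 2 *m Q.
  rewrite mul_col_mx mul_block_col !mul_scalar_mx -!scalemxAl !AT.
  rewrite loop_laplacian_loops loop_laplacian_nonloops.
  have -> : r%:R = 2 * m / N by rewrite mN; field.
  by congr col_mx; apply/rowP => i; rewrite !mxE; field; rewrite -/N -/m N0 m0.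
have -> : - s = P *m col_mx (- 1)%:M 0%:M.
  by rewrite mul_row_col !mul_mx_scalar scale0r addr0 scaleN1r.
have -> : - 2 *: s^T = row_mx (- 2 * N)%:M 0%:M *m Q.
  rewrite mul_row_col !mul_scalar_mx scale0r addr0 scalerA.
  by rewrite mulfK.
exact: bordered_trace.
Qed.

End EquitableLoops.

(** * The line graph of a full-loop graph *)

Section LineGraphOfFullLoop.
Variables (V : finType) (G : sgraph V).
Let K := full_loop G.
Let L := under (line_graph K).
Implicit Types e f : sl_edge K.

Variant sl_edge_spec (E : {set V}) : Prop :=
  | OrdinaryEdge x y of adj G x y & E = [set x; y]%SET
  | LoopEdge v of E = [set v]%SET.

Lemma sl_edgeP e : sl_edge_spec (val e).
Proof.
have := valP e; rewrite finset.in_setU => /orP[].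
- rewrite inE => /existsP[x /existsP[y /andP[xy /eqP ->]]].
  exact: (OrdinaryEdge xy).
- by case/imsetP => v _ ->; exact: LoopEdge.
Qed.

Lemma edge_mem x y : adj G x y -> [set x; y]%SET \in sl_edges K.
Proof.
move=> xy; rewrite finset.in_setU; apply/orP; left; rewrite inE.
by apply/existsP; exists x; apply/existsP; exists y; rewrite xy eqxx.
Qed.

Lemma loop_mem v : [set v]%SET \in sl_edges K.
Proof.
by rewrite finset.in_setU; apply/orP; right; apply: imset_f; rewrite inE.
Qed.

Lemma adj_neq x y : adj G x y -> x != y.
Proof. by apply: contraTneq => ->; rewrite adj_irr. Qed.

Lemma card_edge x y : adj G x y -> #|[set x; y]%SET| = 2%N.
Proof. by move=> /adj_neq xy; rewrite cards2 xy. Qed.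

Lemma line_adjE e f :
  adj L e f = (e != f) && (#|(val e :&: val f)%SET| == 1%N).
Proof. by []. Qed.

Lemma card_set1I v (E : {set V}) :
  (#|([set v] :&: E)%SET| == 1%N) = (v \in E).
Proof.
rewrite finset.setIC; case: (boolP (v \in E)) => vE.
  by rewrite (finset.setIidPr _) ?cards1 // finset.sub1set.
suff -> : (E :&: [set v] = finset.set0)%SET by rewrite cards0.
by apply/eqP; rewrite finset.setI_eq0 disjoint_sym disjoints1.
Qed.

Lemma loops_nonadjacent e f :
  e \in loops (line_graph K) -> f \in loops (line_graph K) -> adj L e f = false.
Proof.
rewrite !inE => /cards1P[v ve] /cards1P[w wf].
rewrite line_adjE ve wf card_set1I inE -val_eqE /= ve wf.
by rewrite (inj_eq finset.set1_inj) andNb.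
Qed.

Lemma val_loops : (val @: loops (line_graph K) = [set [set v] | v : V])%SET.
Proof.
apply/finset.setP => E; apply/imsetP/imsetP => [[e]|[v _ ->]].
  by rewrite inE => /cards1P[v ve] ->; exists v.
by exists (Sub [set v]%SET (loop_mem v)); rewrite ?inE SubK ?cards1.
Qed.

Lemma card_loops : #|loops (line_graph K)| = #|V|.
Proof.
rewrite -(card_imset _ val_inj) val_loops card_imset //; exact: finset.set1_inj.
Qed.

(** The neighbours of the loop at [v] are the edges [set v; w], one for each
    neighbour [w] of [v]. *)
Lemma deg_loop r e : regular G r -> e \in loops (line_graph K) -> deg L e = r.
Proof.
move=> hreg; rewrite inE => /cards1P[v ve].
rewrite -(hreg v) /deg -(card_imset _ val_inj).
have inj_edge :
    {in [set w | adj G v w]%SET &, injective (fun w => [set v; w]%SET)}.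
  move=> w w'; rewrite !inE => /adj_neq vw _ eqw.
  have : w \in [set v; w']%SET by rewrite -eqw !inE eqxx orbT.
  by rewrite !inE eq_sym (negPf vw) => /eqP.
rewrite -(card_in_imset inj_edge); apply: eq_card => E.
apply/imsetP/imsetP => [[f]|[w]]; rewrite inE.
- rewrite line_adjE ve card_set1I -val_eqE /= ve => /andP[ef vf] ->.
  case: (sl_edgeP f) (vf) ef => [x y xy ->|w ->]; last first.
    by rewrite inE => /eqP->; rewrite eqxx.
  rewrite !inE => /orP[] /eqP vxy _; subst v; first by exists y; rewrite ?inE.
  by exists x; rewrite ?inE 1?adj_sym // finset.setUC.
- move=> vw; exists (Sub [set v; w]%SET (edge_mem vw)); rewrite ?SubK //.
  rewrite inE line_adjE ve card_set1I SubK !inE eqxx andbT -val_eqE /= ve.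
  by apply/eqP => /(congr1 (fun E : {set V} => #|E|)); rewrite cards1 card_edge.
Qed.

(** The loops adjacent to an ordinary edge sit at its two ends. *)
Lemma card_loops_at_edge e : e \notin loops (line_graph K) ->
  #|[set f in loops (line_graph K) | adj L e f]%SET| = 2%N.
Proof.
rewrite inE; case: (sl_edgeP e) => [x y xy exy _|v ->]; last by rewrite cards1.
rewrite -(card_imset _ val_inj) -(card_edge xy).
rewrite -(card_imset _ (@finset.set1_inj V)); apply: eq_card => E.
apply/imsetP/imsetP => [[f]|[w wxy ->]].
- rewrite !inE line_adjE => /andP[/cards1P[w wf]] /andP[_].
  by rewrite wf finset.setIC card_set1I exy => wxy ->; exists w.
- exists (Sub [set w]%SET (loop_mem w)); rewrite ?SubK //.
  rewrite !inE line_adjE SubK cards1 finset.setIC card_set1I exy wxy.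
  rewrite -val_eqE /= exy ?andbT.
  by apply/eqP => /(congr1 (fun E : {set V} => #|E|)); rewrite cards1 card_edge.
Qed.

End LineGraphOfFullLoop.

Section RelabelledCounts.
Variables (V W : finType) (lab : W -> V) (K : slgraph V).
Hypothesis hlab : bijective lab.

Lemma card_relabel (p : pred V) : #|[pred i | p (lab i)]| = #|p|.
Proof.
rewrite -!sum1_card [RHS](reindex lab) /=; first exact: eq_bigl.
exact: onW_bij.
Qed.

Lemma card_loops_relabel : #|loops (relabel lab K)| = #|loops K|.
Proof.
rewrite -[RHS](card_relabel (mem (loops K))); apply: eq_card => i.
by rewrite !inE.
Qed.

Lemma deg_relabel i : deg (under (relabel lab K)) i = deg (under K) (lab i).
Proof.
rewrite /deg -[RHS](card_relabel (mem [set y | adj (under K) (lab i) y]%SET)).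
by apply: eq_card => j; rewrite !inE.
Qed.

Lemma card_loops_at_relabel i :
  #|[set j in loops (relabel lab K) | adj (under (relabel lab K)) i j]%SET|
  = #|[set v in loops K | adj (under K) (lab i) v]%SET|.
Proof.
rewrite -[RHS](card_relabel
  (mem [set v in loops K | adj (under K) (lab i) v]%SET)).
by apply: eq_card => j; rewrite !inE.
Qed.

End RelabelledCounts.

Lemma vieta_sqrt (R : rcfType) (p q : R) : 0 <= q ->
  (p - Num.sqrt q) / 2 + (p + Num.sqrt q) / 2 = p /\
  (p - Num.sqrt q) / 2 * ((p + Num.sqrt q) / 2) = (p ^+ 2 - q) / 4.
Proof.
move=> q0; split; first by field.
by rewrite -[in RHS](sqr_sqrtr q0); field.
Qed.

Theorem proposition5p20 (R : realType) (V : finType) (G : sgraph V)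
    (N m r : nat)
    (hN : #|V| = N) (hm : #|edges G| = m) (hmNr : m.*2 = (N * r)%N)
    (hr : (2 <= r)%N) (hconn : connected_graph G) (hreg : regular G r)
    (lab : 'I_(m + N) -> sl_edge (full_loop G)) (hlab : bijective lab)
    (t : R) (ht : 0 < t) :
  let H := relabel lab (line_graph (full_loop G)) in
  let rho1m : R := (r%:R + 3 - Num.sqrt ((r%:R + 1) ^+ 2 + 4 * r%:R)) / 2 in
  let rho1p : R := (r%:R + 3 + Num.sqrt ((r%:R + 1) ^+ 2 + 4 * r%:R)) / 2 in
  let etam : R := (2 * N%:R + r%:R + 3
    - Num.sqrt ((2 * N%:R - r%:R - 1) ^+ 2 + 4 * r%:R)) / 2 in
  let etap : R := (2 * N%:R + r%:R + 3
    + Num.sqrt ((2 * N%:R - r%:R - 1) ^+ 2 + 4 * r%:R)) / 2 in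
  heat_character H t =
    1 + expR (- (etam * t)) + expR (- (etap * t))
      - expR (- (rho1m * t)) - expR (- (rho1p * t)).
Proof.
move=> H rho1m rho1p etam etap.
have cardS : #|loops H| = N by rewrite card_loops_relabel // card_loops.
have cardE : #|~: loops H| = m.
  by apply/eqP; rewrite -(eqn_add2l #|loops H|) cardsC card_ord cardS addnC.
have N_gt0 : (0 < N)%N by rewrite -hN; case: hconn.
have m_gt0 : (0 < m)%N by lia.
have [rho_sum rho_prod] : rho1m + rho1p = r%:R + 3 /\ rho1m * rho1p = 2.
  have [|-> ->] := vieta_sqrt (r%:R + 3)
      (_ : 0 <= (r%:R + 1) ^+ 2 + 4 * r%:R :> R).
    by rewrite addr_ge0 ?sqr_ge0 ?mulr_ge0.
  by split=> //; field.
have [eta_sum eta_prod] : etam + etap = 2 * N%:R + r%:R + 3 /\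
    etam * etap = 2 * N%:R * r%:R + 4 * N%:R + 2.
  have [|-> ->] := vieta_sqrt (2 * N%:R + r%:R + 3)
      (_ : 0 <= (2 * N%:R - r%:R - 1) ^+ 2 + 4 * r%:R :> R).
    by rewrite addr_ge0 ?sqr_ge0 ?mulr_ge0.
  by split=> //; field.
(* The power sums of the two spectra; the leading term is the eigenvalue 0 of
   the constant functions. *)
have trL k : \tr (laplacian R (acikmese_lift H) ^+ k *m perm_mx (lift_invol _))
    = 0 ^+ k + etam ^+ k + etap ^+ k - (rho1m ^+ k + rho1p ^+ k).
  rewrite (@trace_exp_equitable _ _ r); last first.
  - by rewrite cardS cardE -natrM mul2n hmNr natrM.
  - by rewrite cardE pnatr_eq0 -lt0n.
  - by rewrite cardS pnatr_eq0 -lt0n.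
  - move=> i; rewrite inE => iE; rewrite card_loops_at_relabel //.
    exact: card_loops_at_edge.
  - move=> i; rewrite inE => iS; rewrite deg_relabel //; exact: deg_loop.
  - move=> i j; rewrite inE => iS; rewrite inE => jS.
    exact: loops_nonadjacent.
  rewrite cardS; congr (_ - _).
    exact: trace_even.
  exact: trace_odd.
rewrite /heat_character.
rewrite (@mxtrace_mx_exp _ _ _ _ [:: 0; - (etam * t); - (etap * t)]
  [:: - (rho1m * t); - (rho1p * t)]); last first.
  move=> k; rewrite scalemx_exp -scalemxAl mxtraceZ trL.
  have pow x : (- (x * t)) ^+ k = (- t) ^+ k * x ^+ k.
    by rewrite -exprMn mulrC -mulNr mulrC.
  have pow0 : 0 ^+ k = (- t) ^+ k * 0 ^+ k by rewrite -exprMn mulr0.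
  by rewrite !big_cons !big_nil !pow [in RHS]pow0; ring.
by rewrite !big_cons !big_nil expR0 !addr0; ring.
Qed.
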